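(* Let $\mathbb K$ be an algebraically closed field of characteristic $2$ and let $g\ge 2$, $h\ge 1$ be integers. The Jurman algebra $\mathfrak j(g,h)$ is isomorphic to $\mathfrak h:=\mathfrak h_\Pi'(2;(g,h+1))$. For $0\le k<2^{h+1}$ and $0\le l<2^{g-1}$ (whenever the index of $Y$ lies in the range $\{-1,0,\dots,2^{g+h}-3\}$), an isomorphism is given by $$Y_{2^{g-1}k+l-1}(0)\longleftrightarrow p^{(2^{g-1}+l)}q^{(k)}+(k+1)\,p^{(l)}q^{(k+1)},$$ $$Y_{2^{g-1}k+l-2}(1)\longleftrightarrow \begin{cases}p^{(2^{g-1}+l)}q^{(k-1)}+(k+1)\,p^{(l)}q^{(k)}&\text{if }k>0,\\ p^{(l)}&\text{if }k=0,\end{cases}$$ where elements of $\mathfrak h$ are represented by generating functions modulo constants.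
   Context: Divided powers: $\mathcal O(2;(N_1,N_2))$ is the commutative $\mathbb K$-algebra with basis $p^{(a)}q^{(b)}$, $0\le a<2^{N_1}$, $0\le b<2^{N_2}$, and multiplication $p^{(a)}q^{(b)}\cdot p^{(c)}q^{(d)}=\binom{a+c}{a}\binom{b+d}{b}p^{(a+c)}q^{(b+d)}$ (zero if an exponent is out of range, since then the binomial coefficient is even). Here $p^{(0)}=q^{(0)}=1$. The distinguished partial derivatives are $\partial_p(p^{(a)}q^{(b)})=p^{(a-1)}q^{(b)}$ and $\partial_q(p^{(a)}q^{(b)})=p^{(a)}q^{(b-1)}$ (with $p^{(-1)}=q^{(-1)}=0$). The Poisson Lie algebra $\mathfrak{po}_\Pi(2;(N_1,N_2))$ is the space $\mathcal O(2;(N_1,N_2))$ with bracket $\{F,G\}=\partial_pF\,\partial_qG+\partial_qF\,\partial_pG$. Let $\mathfrak h_\Pi(2;(N_1,N_2))=\mathfrak{po}_\Pi(2;(N_1,N_2))/\mathbb K\cdot 1$, and let $\mathfrak h_\Pi'(2;(N_1,N_2))$ be its derived algebra; its elements are written as generating functions modulo constants. For $\mathfrak h_\Pi'(2;(g,h+1))$, $N_1=g$ corresponds to $p$ and $N_2=h+1$ to $q$. Jurman algebra: let $\eta=2^g-1$ and $\varkappa=2^{g+h}$. The Lie algebra $\mathfrak j(g,h)$ over $\mathbb K$ has basis $\{Y_j(t)\mid t\in\{0,1\},\ j\in\{-1,0,\dots,\varkappa-3\}\}$ and bracket $[Y_i(s),Y_j(t)]=b_{s,t}^{i,j}\,Y_{i+j+st(1-\eta)}(s+t)$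 with $s+t$ taken modulo $2$, where $$b_{s,t}^{i,j}=\binom{i+j+1+st(1-\eta)}{i+1}+\binom{i+j+1+st(1-\eta)}{j+1}\pmod 2$$ if $-1\le i+j+st(1-\eta)\le\varkappa-3$, and $b_{s,t}^{i,j}=0$ otherwise. A binomial coefficient $\binom ab$ is taken to be $0$ unless $0\le b\le a$. *)

(* Defs.v *)
From HB Require Import structures.
From mathcomp Require Import all_boot all_order all_algebra.
From mathcomp Require Import generic_quotient ring_quotient ring zify.

Set Implicit Arguments.
Unset Strict Implicit.
Unset Printing Implicit Defensive.

Import GRing.Theory.

Local Open Scope ring_scope.
Local Open Scope quotient_scope.

Declare Scope lie_scope.
Reserved Notation "{[ x , y ]}" (at level 0, format "{[ x ,  y ]}").

(* Finite-dimensional spaces with a bilinear bracket.  The Lie identities are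
   kept apart, in [lie_axioms]: they hold for the algebras below only in
   characteristic 2, whereas their brackets make sense over any field. *)
HB.mixin Record hasBracket (K : fieldType) V of Vector K V := {
  bracket : V -> V -> V;
  bracket_linearl : forall y, linear (bracket^~ y);
  bracket_linearr : forall x, linear (bracket x)
}.

#[short(type="bracketAlgType")]
HB.structure Definition BracketAlg (K : fieldType) :=
  {V of hasBracket K V & Vector K V}.

Notation "{[ x , y ]}" := (bracket x y) : lie_scope.
Local Open Scope lie_scope.

Definition lie_axioms (K : fieldType) (L : bracketAlgType K) : Prop :=
  (forall x : L, {[x, x]} = 0) /\
  (forall x y z : L, {[x, {[y, z]}]} + {[y, {[z, x]}]} + {[z, {[x, y]}]} = 0).

Definition lie_iso (K : fieldType) (L M : bracketAlgType K)
    (f : {linear L -> M}) : Prop :=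
  bijective f /\ {morph f : x y / {[x, y]} >-> {[x, y]}}.

Section BracketTheory.
Variables (K : fieldType) (L : bracketAlgType K).
Implicit Types (x y z : L) (a : K).

HB.instance Definition _ x :=
  GRing.isLinear.Build K L L *:%R (bracket x) (bracket_linearr x).

Definition rbracket y x := {[x, y]}.

HB.instance Definition _ y :=
  GRing.isLinear.Build K L L *:%R (rbracket y) (bracket_linearl y).

Lemma bracketDr x y z : {[x, y + z]} = {[x, y]} + {[x, z]}.
Proof. exact: raddfD. Qed.
Lemma bracketBr x y z : {[x, y - z]} = {[x, y]} - {[x, z]}.
Proof. exact: raddfB. Qed.
Lemma bracketZr a x y : {[x, a *: y]} = a *: {[x, y]}.
Proof. exact: linearZ. Qed.
Lemma bracket_sumr (I : Type) (r : seq I) (P : pred I) (F : I -> L) x :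
  {[x, \sum_(i <- r | P i) F i]} = \sum_(i <- r | P i) {[x, F i]}.
Proof. exact: raddf_sum. Qed.

Lemma bracketDl x y z : {[x + y, z]} = {[x, z]} + {[y, z]}.
Proof. exact: (raddfD (rbracket z)). Qed.
Lemma bracketBl x y z : {[x - y, z]} = {[x, z]} - {[y, z]}.
Proof. exact: (raddfB (rbracket z)). Qed.
Lemma bracketZl a x y : {[a *: x, y]} = a *: {[x, y]}.
Proof. exact: (linearZZ (rbracket y)). Qed.
Lemma bracket_suml (I : Type) (r : seq I) (P : pred I) (F : I -> L) y :
  {[\sum_(i <- r | P i) F i, y]} = \sum_(i <- r | P i) {[F i, y]}.
Proof. exact: (raddf_sum (rbracket y)). Qed.

End BracketTheory.

Lemma lie_iso_axioms (K : fieldType) (L M : bracketAlgType K)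
  (f : {linear L -> M}) : lie_iso f -> lie_axioms M -> lie_axioms L.
Proof.
case=> /bij_inj inj_f fM [alt jac]; split=> [x | x y z]; apply: inj_f.
  by rewrite fM alt linear0.
by rewrite !linearD /= !fM jac linear0.
Qed.

Record lieIdeal (K : fieldType) (L : bracketAlgType K) := LieIdeal {
  ideal_space :> {vspace L};
  ideal_bracketr : forall x y, y \in ideal_space -> {[x, y]} \in ideal_space;
  ideal_bracketl : forall x y, x \in ideal_space -> {[x, y]} \in ideal_space
}.

Section LieQuotient.
Import VectorInternalTheory.
Variables (K : fieldType) (L : bracketAlgType K) (I : lieIdeal L).
Local Notation U := (ideal_space I).

Definition lieQuot : Type := Quotient.quot (pred_of_vspace U).

HB.instance Definition _ :=
  ZmodQuotient.copy lieQuot (Quotient.quot (pred_of_vspace U)).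

Lemma lieQuot_eqP (x y : L) :
  reflect (\pi_lieQuot x = \pi_lieQuot y) (x - y \in U).
Proof.
have -> : (x - y \in U) = (x == y %[mod lieQuot]).
  exact: (Quotient.idealrBE (pred_of_vspace U) x y).
exact: eqP.
Qed.

Lemma lieQuot_piD (x y : L) :
  \pi_lieQuot (x + y) = \pi_lieQuot x + \pi_lieQuot y.
Proof. by rewrite !piE. Qed.

Definition lieQuot_scale (a : K) := lift_op1 lieQuot ( *:%R a).

Lemma lieQuot_pi_scale (a : K) (x : L) :
  lieQuot_scale a (\pi_lieQuot x) = \pi_lieQuot (a *: x).
Proof.
unlock lieQuot_scale; apply/lieQuot_eqP; rewrite -scalerBr memvZ //.
by apply/lieQuot_eqP; rewrite reprK.
Qed.

Fact lieQuot_scaleA a b u :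
  lieQuot_scale a (lieQuot_scale b u) = lieQuot_scale (a * b) u.
Proof. by elim/quotW: u => x; rewrite !lieQuot_pi_scale scalerA. Qed.
Fact lieQuot_scale1 : left_id 1 lieQuot_scale.
Proof. by elim/quotW=> x; rewrite lieQuot_pi_scale scale1r. Qed.
Fact lieQuot_scaleDr : right_distributive lieQuot_scale +%R.
Proof.
move=> a; elim/quotW=> x; elim/quotW=> y.
by rewrite -lieQuot_piD !lieQuot_pi_scale scalerDr lieQuot_piD.
Qed.
Fact lieQuot_scaleDl u : {morph lieQuot_scale^~ u : a b / a + b}.
Proof.
by elim/quotW: u => x a b; rewrite !lieQuot_pi_scale scalerDl lieQuot_piD.
Qed.

HB.instance Definition _ := GRing.Zmodule_isLmodule.Build K lieQuot
  lieQuot_scaleA lieQuot_scale1 lieQuot_scaleDr lieQuot_scaleDl.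

Fact lieQuot_pi_linear : linear \pi_lieQuot.
Proof. by move=> a x y; rewrite lieQuot_piD -lieQuot_pi_scale. Qed.

Definition lieQuot_pi : L -> lieQuot := \pi_lieQuot.

HB.instance Definition _ :=
  GRing.isLinear.Build K L lieQuot *:%R lieQuot_pi lieQuot_pi_linear.

Fact lieQuot_vect_axiom : Vector.axiom (dim (subvs_of U^C)) lieQuot.
Proof.
have capUC : (U^C :&: U = 0)%VS by rewrite capvC capv_compl.
have addUC x : daddv_pi U^C U x + daddv_pi U U^C x = x.
  by rewrite daddv_pi_add // addvC addv_complf memvf.
pose p (x : L) := vsproj U^C (daddv_pi U^C U x).
have pP x y : \pi_lieQuot x = \pi_lieQuot y -> p x = p y.
  move/lieQuot_eqP => xyU; congr vsproj; apply/eqP.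
  rewrite -subr_eq0 -linearB /=.
  have := addUC (x - y); rewrite (daddv_pi_id (capv_compl U)) //.
  by move/(canRL (addrK _)) ->; rewrite subrr.
have pK x : \pi_lieQuot (vsval (p x)) = \pi_lieQuot x.
  apply/lieQuot_eqP; rewrite vsprojK ?memv_pi //.
  by rewrite -{2}[x]addUC opprD addNKr rpredN memv_pi.
exists (fun u : lieQuot => v2r (p (repr u))).
  move=> a u v; rewrite -linearP; congr v2r; rewrite /p -!linearP.
  by apply: pP; rewrite reprK lieQuot_pi_linear !reprK.
exists (fun r => \pi_lieQuot (vsval (r2v r : subvs_of U^C))) => [u | r].
  by rewrite v2rK pK reprK.
rewrite -[RHS]r2vK; congr v2r; set w := r2v r.
have -> : w = p (vsval w) by rewrite /p daddv_pi_id ?subvsP ?vsvalK.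
by apply: pP; rewrite reprK pK.
Qed.

HB.instance Definition _ :=
  Lmodule_hasFinDim.Build K lieQuot lieQuot_vect_axiom.

Definition lieQuot_bracket := lift_op2 lieQuot (@bracket K L).

Lemma lieQuot_pi_bracket (x y : L) :
  lieQuot_bracket (\pi_lieQuot x) (\pi_lieQuot y) = \pi_lieQuot {[x, y]}.
Proof.
have repU z : repr (\pi_lieQuot z) - z \in U.
  by apply/lieQuot_eqP; rewrite reprK.
unlock lieQuot_bracket; apply/lieQuot_eqP; set x' := repr _; set y' := repr _.
have -> : {[x', y']} - {[x, y]} = {[x' - x, y']} + {[x, y' - y]}.
  by rewrite bracketBl bracketBr addrA subrK.
by apply: memvD; [apply: ideal_bracketl | apply: ideal_bracketr]; apply: repU.
Qed.

Fact lieQuot_bracket_linearl v : linear (lieQuot_bracket^~ v).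
Proof.
elim/quotW: v => v a; elim/quotW=> u; elim/quotW=> w.
by rewrite -lieQuot_pi_linear !lieQuot_pi_bracket
  bracketDl bracketZl lieQuot_pi_linear.
Qed.
Fact lieQuot_bracket_linearr u : linear (lieQuot_bracket u).
Proof.
elim/quotW: u => u a; elim/quotW=> v; elim/quotW=> w.
by rewrite -lieQuot_pi_linear !lieQuot_pi_bracket
  bracketDr bracketZr lieQuot_pi_linear.
Qed.

HB.instance Definition _ := hasBracket.Build K lieQuot
  lieQuot_bracket_linearl lieQuot_bracket_linearr.

Lemma pi_bracket (x y : L) :
  \pi_lieQuot {[x, y]} = {[\pi_lieQuot x, \pi_lieQuot y]}.
Proof. by rewrite -lieQuot_pi_bracket. Qed.

Lemma lieQuot_lie : lie_axioms L -> lie_axioms lieQuot.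
Proof.
case=> alt jac; split=> [u | u v w].
  by elim/quotW: u => x; rewrite -pi_bracket alt (raddf0 lieQuot_pi).
elim/quotW: u => u; elim/quotW: v => v; elim/quotW: w => w.
rewrite -!pi_bracket -!lieQuot_piD jac; exact: (raddf0 lieQuot_pi).
Qed.

End LieQuotient.

Section DerivedAlgebra.
Variables (K : fieldType) (L : bracketAlgType K).

Definition derived : {vspace L} :=
  <<[seq {[x, y]} | x <- vbasis {:L}, y <- vbasis {:L}]>>%VS.

Lemma mem_derived (x y : L) : {[x, y]} \in derived.
Proof.
rewrite (coord_vbasis (memvf x)) (coord_vbasis (memvf y)) bracket_suml.
apply: memv_suml => i _; rewrite bracket_sumr; apply: memv_suml => j _.
rewrite bracketZl bracketZr !memvZ // memv_span //.
by apply: allpairs_f; rewrite mem_nth ?size_tuple.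
Qed.

Lemma derived_min (W : {vspace L}) :
  (forall x y, {[x, y]} \in W) -> (derived <= W)%VS.
Proof. by move=> sW; apply/span_subvP => _ /allpairsP[p [_ _ ->]]. Qed.

Definition derivedAlg : Type := subvs_of derived.

HB.instance Definition _ := Vector.copy derivedAlg (subvs_of derived).

Definition derived_bracket (u v : derivedAlg) : derivedAlg :=
  vsproj derived {[vsval u, vsval v]}.

Fact derived_bracket_linearl v : linear (derived_bracket^~ v).
Proof.
move=> a u w; rewrite /derived_bracket -linearP; congr vsproj.
by rewrite (linearP (@vsval K L derived)) bracketDl bracketZl.
Qed.
Fact derived_bracket_linearr u : linear (derived_bracket u).
Proof.
move=> a v w; rewrite /derived_bracket -linearP; congr vsproj.
by rewrite (linearP (@vsval K L derived)) bracketDr bracketZr.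
Qed.

HB.instance Definition _ := hasBracket.Build K derivedAlg
  derived_bracket_linearl derived_bracket_linearr.

Lemma derived_bracketE (u v : derivedAlg) :
  vsval {[u, v]} = {[vsval u, vsval v]}.
Proof. by rewrite vsprojK ?mem_derived. Qed.

Lemma derivedAlg_lie : lie_axioms L -> lie_axioms derivedAlg.
Proof.
case=> alt jac; split=> [u | u v w]; apply: subvs_inj.
  by rewrite derived_bracketE alt (linear0 (@vsval K L derived)).
have vsvalD (x y : derivedAlg) : vsval (x + y) = vsval x + vsval y.
  exact: (linearD (@vsval K L derived)).
rewrite !vsvalD !derived_bracketE jac.
by rewrite (linear0 (@vsval K L derived)).
Qed.

End DerivedAlgebra.

(* The divided power algebra O(2; (N1, N2)): F a b is the coefficient of p^(a) q^(b) in F. *)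
Definition divpow (K : fieldType) (N1 N2 : nat) : Type :=
  'M[K]_(2 ^ N1, 2 ^ N2).

HB.instance Definition _ K N1 N2 :=
  Vector.copy (divpow K N1 N2) 'M[K]_(2 ^ N1, 2 ^ N2).

(* p^(a) q^(b), which is 0 when an exponent is out of range *)
Definition pq (K : fieldType) (N1 N2 a b : nat) : divpow K N1 N2 :=
  \matrix_(i < 2 ^ N1, j < 2 ^ N2) ((i == a :> nat) && (j == b :> nat))%:R.

Arguments pq {K N1 N2} a b.

Section DividedPowers.
Variables (K : fieldType) (N1 N2 : nat).
Local Notation O := (divpow K N1 N2).
Implicit Types (F G H : O) (a b c d : nat) (x : K).

Lemma pq_out a b : ~~ ((a < 2 ^ N1) && (b < 2 ^ N2))%N -> pq a b = 0 :> O.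
Proof.
move=> out; apply/matrixP=> i j; rewrite !mxE.
by have [/andP[/eqP ia /eqP jb]|//] := boolP (_ && _);
  rewrite -ia -jb !ltn_ord in out.
Qed.

Lemma pq_sum F : F = \sum_u F u.1 u.2 *: pq u.1 u.2.
Proof.
rewrite {1}[F]matrix_sum_delta pair_bigA; apply: eq_bigr => u _ /=.
by congr (_ *: _); apply/matrixP=> i j; rewrite !mxE.
Qed.

Lemma divpow_ind (P : O -> Prop) : P 0 ->
  (forall x F G, P F -> P G -> P (x *: F + G)) ->
  (forall a b, (a < 2 ^ N1)%N -> (b < 2 ^ N2)%N -> P (pq a b)) ->
  forall F, P F.
Proof.
move=> P0 Plin Ppq F; rewrite [F]pq_sum.
elim/big_rec: _ => // u G _ PG; apply: (Plin) => //.
by apply: Ppq; apply: ltn_ord.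
Qed.

Definition dp_mul F G : O :=
  \sum_u \sum_v (F u.1 u.2 * G v.1 v.2 * ('C(u.1 + v.1, u.1) * 'C(u.2 + v.2, u.2))%:R)
    *: pq (u.1 + v.1) (u.2 + v.2).

Fact dp_mul_linearl G : linear (dp_mul^~ G).
Proof.
move=> x F H; rewrite /dp_mul scaler_sumr -big_split; apply: eq_bigr => u _ /=.
rewrite scaler_sumr -big_split; apply: eq_bigr => v _ /=.
by rewrite !mxE scalerA -scalerDl !mulrDl !mulrA.
Qed.

Fact dp_mulC : commutative dp_mul.
Proof.
move=> F G; rewrite /dp_mul exchange_big; apply: eq_bigr => v _.
apply: eq_bigr => u _; rewrite [F _ _ * _]mulrC addnC [(u.2 + _)%N]addnC.
by rewrite -(bin_sub (leq_addr u.1 _)) -(bin_sub (leq_addr u.2 _)) !addKn.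
Qed.

Fact dp_mul_linearr F : linear (dp_mul F).
Proof.
by move=> x G H; rewrite dp_mulC dp_mul_linearl ![dp_mul _ F]dp_mulC.
Qed.

Lemma dp_mul_pq a b c d : dp_mul (pq a b) (pq c d) =
  ('C(a + c, a) * 'C(b + d, b))%:R *: pq (a + c) (b + d).
Proof.
have dp0l G : dp_mul 0 G = 0.
  by have := dp_mul_linearl G (-1) 0 0; rewrite scaler0 addr0 scaleN1r addNr.
have [/andP[ha hb]|out] := boolP ((a < 2 ^ N1) && (b < 2 ^ N2))%N; last first.
  rewrite (pq_out out) dp0l [X in _ *: X]pq_out ?scaler0 //.
  by apply: contra out => /andP[/(leq_ltn_trans (leq_addr _ _)) ->
    /(leq_ltn_trans (leq_addr _ _)) ->].
have [/andP[hc hd]|out] := boolP ((c < 2 ^ N1) && (d < 2 ^ N2))%N; last first.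
  rewrite (pq_out out) dp_mulC dp0l [X in _ *: X]pq_out ?scaler0 //.
  by apply: contra out => /andP[/(leq_ltn_trans (leq_addl _ _)) ->
    /(leq_ltn_trans (leq_addl _ _)) ->].
rewrite /dp_mul (bigD1 (Ordinal ha, Ordinal hb)) //=.
rewrite [X in _ + X]big1 ?addr0 => [|u uab]; last first.
  apply: big1 => v _; rewrite mxE.
  rewrite -[_ && _]/(u == (Ordinal ha, Ordinal hb)) (negPf uab).
  by rewrite mulr0n !mul0r scale0r.
rewrite (bigD1 (Ordinal hc, Ordinal hd)) //=.
rewrite [X in _ + X]big1 ?addr0 => [|v vcd]; last first.
  rewrite [X in _ * X * _]mxE.
  rewrite -[_ && _]/(v == (Ordinal hc, Ordinal hd)) (negPf vcd).
  by rewrite mulr0n mulr0 mul0r scale0r.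
by rewrite !mxE /= !eqxx !mul1r.
Qed.

Fact dp_mul1 : left_id (pq 0 0) dp_mul.
Proof.
elim/divpow_ind=> [|x F G PF PG|a b _ _].
- by have := dp_mul_linearr (pq 0 0) (-1) 0 0; rewrite scaler0 addr0 scaleN1r addNr.
- by rewrite dp_mul_linearr PF PG.
- by rewrite dp_mul_pq !add0n !bin0 scale1r.
Qed.

Fact dp_mul0F G : dp_mul 0 G = 0.
Proof. by have := dp_mul_linearl G (-1) 0 0; rewrite scaler0 addr0 scaleN1r addNr. Qed.
Fact dp_mulF0 G : dp_mul G 0 = 0.
Proof. by rewrite dp_mulC dp_mul0F. Qed.
Fact dp_mulZl x F G : dp_mul (x *: F) G = x *: dp_mul F G.
Proof. by have := dp_mul_linearl G x F 0; rewrite dp_mul0F !addr0. Qed.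
Fact dp_mulZr x F G : dp_mul F (x *: G) = x *: dp_mul F G.
Proof. by have := dp_mul_linearr F x G 0; rewrite dp_mulF0 !addr0. Qed.

Fact dp_mulA : associative dp_mul.
Proof.
move=> F G H.
elim/divpow_ind: F => [|x F F' PF PF'|a b _ _]; first by rewrite !dp_mul0F.
  by rewrite !dp_mul_linearl PF PF'.
elim/divpow_ind: G => [|x G G' PG PG'|c d _ _]; first by rewrite !(dp_mul0F, dp_mulF0).
  by rewrite !(dp_mul_linearl, dp_mul_linearr) PG PG'.
elim/divpow_ind: H => [|x H H' PH PH'|e f _ _]; first by rewrite !dp_mulF0.
  by rewrite !dp_mul_linearr PH PH'.
have binA k l m :
    ('C(l + m, l) * 'C(k + (l + m), k) = 'C(k + l, k) * 'C(k + l + m, k + l))%N.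
  have pos : (0 < k`! * l`! * m`!)%N by rewrite !muln_gt0 !fact_gt0.
  apply/eqP; rewrite -(eqn_pmul2r pos); apply/eqP.
  have f2 i j : ('C(i + j, i) * (i`! * j`!) = (i + j)`!)%N.
    by rewrite -(bin_fact (leq_addr j i)) addKn.
  transitivity (k + l + m)`!.
    by rewrite -addnA -f2 -[in RHS]f2; nia.
  by rewrite -f2 -[in LHS](f2 k l); nia.
rewrite !dp_mul_pq dp_mulZl dp_mulZr !dp_mul_pq !scalerA -!natrM !addnA.
congr (_%:R *: _); have := binA a c e; have := binA b d f; rewrite !addnA.
by nia.
Qed.

Fact dp_one_neq0 : pq 0 0 != 0 :> O.
Proof.
have p2 N : (0 < 2 ^ N)%N by rewrite expn_gt0.
apply/eqP=> /matrixP/(_ (Ordinal (p2 N1)) (Ordinal (p2 N2))).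
by rewrite !mxE /= => /eqP; rewrite oner_eq0.
Qed.

Fact dp_mulDl : left_distributive dp_mul +%R.
Proof. by move=> F G H; have := dp_mul_linearl H 1 F G; rewrite !scale1r. Qed.

HB.instance Definition _ := GRing.Zmodule_isComNzRing.Build O
  dp_mulA dp_mulC dp_mul1 dp_mulDl dp_one_neq0.
HB.instance Definition _ := GRing.Lmodule_isLalgebra.Build K O
  (fun x F G => esym (dp_mulZl x F G)).
HB.instance Definition _ := GRing.Lalgebra_isComAlgebra.Build K O.

Lemma pqM a b c d : pq a b * pq c d =
  ('C(a + c, a) * 'C(b + d, b))%:R *: pq (a + c) (b + d) :> O.
Proof. exact: dp_mul_pq. Qed.

Lemma pq00 : pq 0 0 = 1 :> O.
Proof. by []. Qed.

Definition dp_p F : O :=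
  \sum_u F u.1 u.2 *: (if u.1 == 0 :> nat then 0 else pq u.1.-1 u.2).
Definition dp_q F : O :=
  \sum_u F u.1 u.2 *: (if u.2 == 0 :> nat then 0 else pq u.1 u.2.-1).

Fact dp_p_linear : linear dp_p.
Proof.
move=> x F G; rewrite scaler_sumr -big_split; apply: eq_bigr => u _ /=.
by rewrite !mxE scalerA -scalerDl.
Qed.
Fact dp_q_linear : linear dp_q.
Proof.
move=> x F G; rewrite scaler_sumr -big_split; apply: eq_bigr => u _ /=.
by rewrite !mxE scalerA -scalerDl.
Qed.

HB.instance Definition _ := GRing.isLinear.Build K O O *:%R dp_p dp_p_linear.
HB.instance Definition _ := GRing.isLinear.Build K O O *:%R dp_q dp_q_linear.


Lemma dp_p_pq a b : (a < 2 ^ N1)%N -> (b < 2 ^ N2)%N ->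
  dp_p (pq a b) = (if a == 0 then 0 else pq a.-1 b).
Proof.
move=> ha hb; rewrite /dp_p (bigD1 (Ordinal ha, Ordinal hb)) //= big1 ?addr0.
  by rewrite mxE !eqxx scale1r.
move=> u uab; rewrite mxE -[_ && _]/(u == (Ordinal ha, Ordinal hb)).
by rewrite (negPf uab) scale0r.
Qed.
Lemma dp_q_pq a b : (a < 2 ^ N1)%N -> (b < 2 ^ N2)%N ->
  dp_q (pq a b) = (if b == 0 then 0 else pq a b.-1).
Proof.
move=> ha hb; rewrite /dp_q (bigD1 (Ordinal ha, Ordinal hb)) //= big1 ?addr0.
  by rewrite mxE !eqxx scale1r.
move=> u uab; rewrite mxE -[_ && _]/(u == (Ordinal ha, Ordinal hb)).
by rewrite (negPf uab) scale0r.
Qed.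

Lemma dp_p_pqE a b :
  dp_p (pq a b) = ((0 < a) && (a < 2 ^ N1))%N%:R *: pq a.-1 b.
Proof.
have [ha|ha] := ltnP a (2 ^ N1); last first.
  by rewrite andbF scale0r pq_out ?linear0 // ltnNge ha.
have [hb|hb] := ltnP b (2 ^ N2); last first.
  by rewrite !pq_out ?linear0 ?scaler0 // [(b < _)%N]ltnNge hb andbF.
by rewrite dp_p_pq // andbT; case: a ha => [|a] _; rewrite ?scale0r ?scale1r.
Qed.
Lemma dp_q_pqE a b :
  dp_q (pq a b) = ((0 < b) && (b < 2 ^ N2))%N%:R *: pq a b.-1.
Proof.
have [hb|hb] := ltnP b (2 ^ N2); last first.
  by rewrite andbF scale0r pq_out ?linear0 // [(b < _)%N]ltnNge hb andbF.
have [ha|ha] := ltnP a (2 ^ N1); last first.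
  by rewrite !pq_out ?linear0 ?scaler0 // ltnNge ha.
by rewrite dp_q_pq // andbT; case: b hb => [|b] _; rewrite ?scale0r ?scale1r.
Qed.

Lemma dp_p1 : dp_p 1 = 0.
Proof. by rewrite -pq00 dp_p_pq ?expn_gt0. Qed.
Lemma dp_q1 : dp_q 1 = 0.
Proof. by rewrite -pq00 dp_q_pq ?expn_gt0. Qed.

Lemma dp_pqC F : dp_p (dp_q F) = dp_q (dp_p F).
Proof.
elim/divpow_ind: F => [|x F G PF PG|a b ha hb]; first by rewrite !linear0.
  by rewrite !(dp_p_linear, dp_q_linear) PF PG.
by rewrite dp_q_pqE dp_p_pqE !linearZ /= dp_q_pqE dp_p_pqE !scalerA mulrC.
Qed.

Hypothesis charK : 2%N \in [pchar K].

Lemma natr_odd n : n%:R = (odd n)%:R :> K.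
Proof.
rewrite -{1}[n]odd_double_half natrD -mul2n natrM (pcharf0 charK) mul0r.
by rewrite addr0.
Qed.

Lemma odd_bin_pow2 N k : (0 < k < 2 ^ N)%N -> odd 'C(2 ^ N, k) = false.
Proof.
case: k => // k /= ltkN; apply/negP=> oddC.
have p2 : (0 < 2 ^ N)%N by rewrite expn_gt0.
have eq := mul_bin_diag (2 ^ N) k.
have dvd : (2 ^ N %| k.+1 * 'C(2 ^ N, k.+1))%N by rewrite -eq dvdn_mulr.
rewrite Gauss_dvdl ?coprimeXl ?coprime2n // in dvd.
by have := dvdn_leq (ltn0Sn k) dvd; rewrite leqNgt ltkN.
Qed.

Lemma leibniz_bin N a c : (a < 2 ^ N)%N -> (c < 2 ^ N)%N ->
  (a + c <= 2 ^ N)%N ->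
  ((0 < a) * 'C(a.-1 + c, a.-1) + (0 < c) * 'C(a + c.-1, a))%N%:R
    = ('C(a + c, a) * ((0 < a + c) && (a + c < 2 ^ N)))%N%:R :> K.
Proof.
case: a c => [|a] [|c] //= ha hc le; rewrite ?addn0 ?add0n ?mul0n ?mul1n.
- by rewrite !bin0 hc.
- by rewrite !binn ha.
have -> : ('C(a + c.+1, a) + 'C(a.+1 + c, a.+1) = 'C(a.+1 + c.+1, a.+1))%N.
  by rewrite [in RHS]addSn binS addSnnS addnC.
have [lt|ge] := ltnP; first by rewrite muln1.
have eq : (a.+1 + c.+1 = 2 ^ N)%N by apply/eqP; rewrite eqn_leq le ge.
by rewrite muln0 eq natr_odd odd_bin_pow2.
Qed.

Lemma dp_pM F G : dp_p (F * G) = dp_p F * G + F * dp_p G.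
Proof.
elim/divpow_ind: F => [|x F F' PF PF'|a b ha hb].
- by rewrite linear0 !mul0r linear0 addr0.
- rewrite mulrDl -scalerAl !dp_p_linear PF PF' !mulrDl -!scalerAl scalerDr.
  by rewrite -!addrA; congr (_ + _); rewrite addrCA.
elim/divpow_ind: G => [|x G G' PG PG'|c d hc hd].
- by rewrite linear0 !mulr0 linear0 addr0.
- rewrite mulrDr -scalerAr !dp_p_linear PG PG' !mulrDr -!scalerAr scalerDr.
  by rewrite -!addrA; congr (_ + _); rewrite addrCA.
rewrite pqM linearZ /= !dp_p_pqE ha hc !andbT -scalerAl -scalerAr !pqM !scalerA.
have pE : ((0 < a)%N%:R * ('C(a.-1 + c, a.-1) * 'C(b + d, b))%:R) *:
    pq (a.-1 + c) (b + d) =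
  (((0 < a) * 'C(a.-1 + c, a.-1))%N%:R * 'C(b + d, b)%:R) *:
    pq (a + c).-1 (b + d) :> O.
  by case: (a) => [|a']; rewrite ?mul0n ?mul0r ?scale0r // mul1n natrM mul1r.
have qE : ((0 < c)%N%:R * ('C(a + c.-1, a) * 'C(b + d, b))%:R) *:
    pq (a + c.-1) (b + d) =
  (((0 < c) * 'C(a + c.-1, a))%N%:R * 'C(b + d, b)%:R) *:
    pq (a + c).-1 (b + d) :> O.
  case: (c) => [|c']; rewrite ?mul0n ?mul0r ?scale0r // mul1n natrM mul1r.
  by rewrite addnS.
rewrite pE qE -scalerDl -mulrDl -natrD.
have [le|gt] := leqP (a + c) (2 ^ N1).
  by rewrite (leibniz_bin ha hc le) !natrM; congr (_ *: _); ring.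
have out : (2 ^ N1 <= (a + c).-1)%N by lia.
by rewrite [pq _.-1 _]pq_out ?scaler0 // ltnNge out.
Qed.

Lemma dp_qM F G : dp_q (F * G) = dp_q F * G + F * dp_q G.
Proof.
elim/divpow_ind: F => [|x F F' PF PF'|a b ha hb].
- by rewrite linear0 !mul0r linear0 addr0.
- rewrite mulrDl -scalerAl !dp_q_linear PF PF' !mulrDl -!scalerAl scalerDr.
  by rewrite -!addrA; congr (_ + _); rewrite addrCA.
elim/divpow_ind: G => [|x G G' PG PG'|c d hc hd].
- by rewrite linear0 !mulr0 linear0 addr0.
- rewrite mulrDr -scalerAr !dp_q_linear PG PG' !mulrDr -!scalerAr scalerDr.
  by rewrite -!addrA; congr (_ + _); rewrite addrCA.
rewrite pqM linearZ /= !dp_q_pqE hb hd !andbT -scalerAl -scalerAr !pqM !scalerA.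
have pE : ((0 < b)%N%:R * ('C(a + c, a) * 'C(b.-1 + d, b.-1))%:R) *:
    pq (a + c) (b.-1 + d) =
  (((0 < b) * 'C(b.-1 + d, b.-1))%N%:R * 'C(a + c, a)%:R) *:
    pq (a + c) (b + d).-1 :> O.
  case: (b) => [|b']; rewrite ?mul0n ?mul0r ?scale0r // mul1n natrM mul1r.
  by rewrite mulrC.
have qE : ((0 < d)%N%:R * ('C(a + c, a) * 'C(b + d.-1, b))%:R) *:
    pq (a + c) (b + d.-1) =
  (((0 < d) * 'C(b + d.-1, b))%N%:R * 'C(a + c, a)%:R) *:
    pq (a + c) (b + d).-1 :> O.
  case: (d) => [|d']; rewrite ?mul0n ?mul0r ?scale0r // mul1n natrM mul1r.
  by rewrite addnS mulrC.
rewrite pE qE -scalerDl -mulrDl -natrD.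
have [le|gt] := leqP (b + d) (2 ^ N2).
  by rewrite (leibniz_bin hb hd le) !natrM; congr (_ *: _); ring.
have out : (2 ^ N2 <= (b + d).-1)%N by lia.
by rewrite [pq _ _.-1]pq_out ?scaler0 // andbC ltnNge out.
Qed.

End DividedPowers.

(* The Poisson Lie algebra po_Pi(2; (N1, N2)) *)
Definition po (K : fieldType) (N1 N2 : nat) : Type := divpow K N1 N2.

HB.instance Definition _ K N1 N2 := Vector.copy (po K N1 N2) (divpow K N1 N2).

Section Poisson.
Variables (K : fieldType) (N1 N2 : nat).
Local Notation O := (divpow K N1 N2).

Definition poisson (F G : O) : O := dp_p F * dp_q G + dp_q F * dp_p G.

Fact poisson_linearl G : linear (poisson^~ G).
Proof.
move=> x F H; rewrite /poisson dp_p_linear dp_q_linear !mulrDl -!scalerAl.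
by rewrite scalerDr -!addrA; congr (_ + _); rewrite addrCA.
Qed.
Fact poisson_linearr F : linear (poisson F).
Proof.
move=> x G H; rewrite /poisson dp_p_linear dp_q_linear !mulrDr -!scalerAr.
by rewrite scalerDr -!addrA; congr (_ + _); rewrite addrCA.
Qed.

HB.instance Definition _ := hasBracket.Build K (po K N1 N2)
  poisson_linearl poisson_linearr.

Lemma po_lie : 2%N \in [pchar K] -> lie_axioms (po K N1 N2).
Proof.
move=> charK; have xx0 (F : O) : F + F = 0.
  by rewrite -mulr2n -scaler_nat (pcharf0 charK) scale0r.
split=> [F | F G H]; first by rewrite -[LHS]/(_ * _ + _ * _) mulrC xx0.
rewrite -[LHS]/(poisson F (poisson G H) + poisson G (poisson H F)
  + poisson H (poisson F G)).
rewrite /poisson !(linearD (@dp_p _ _ _), linearD (@dp_q _ _ _)) /=.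
rewrite !(dp_pM charK, dp_qM charK) !dp_pqC.
set Fp := dp_p F; set Gp := dp_p G; set Hp := dp_p H.
set Fq := dp_q F; set Gq := dp_q G; set Hq := dp_q H.
set Fpp := dp_p Fp; set Gpp := dp_p Gp; set Hpp := dp_p Hp.
set Fpq := dp_q Fp; set Gpq := dp_q Gp; set Hpq := dp_q Hp.
set Fqq := dp_q Fq; set Gqq := dp_q Gq; set Hqq := dp_q Hq.
rewrite -[RHS](xx0 (Fpq * (Gp * Hq + Gq * Hp) + Gpq * (Fp * Hq + Fq * Hp)
  + Hpq * (Fp * Gq + Fq * Gp) + Fqq * Gp * Hp + Gqq * Fp * Hp + Hqq * Fp * Gp
  + Fpp * Gq * Hq + Gpp * Fq * Hq + Hpp * Fq * Gq)).
ring.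
Qed.

Definition po_const : {vspace po K N1 N2} := <[(1 : O) : po K N1 N2]>%VS.

Fact po_const_bracketr (F G : po K N1 N2) :
  G \in po_const -> {[F, G]} \in po_const.
Proof.
case/vlineP=> x ->; rewrite bracketZr.
have -> : {[F, (1 : O) : po K N1 N2]} = 0.
  by rewrite -[LHS]/(poisson F 1) /poisson dp_p1 dp_q1 !mulr0 addr0.
by rewrite scaler0 mem0v.
Qed.
Fact po_const_bracketl (F G : po K N1 N2) :
  F \in po_const -> {[F, G]} \in po_const.
Proof.
case/vlineP=> x ->; rewrite bracketZl.
have -> : {[(1 : O) : po K N1 N2, G]} = 0.
  by rewrite -[LHS]/(poisson 1 G) /poisson dp_p1 dp_q1 !mul0r addr0.
by rewrite scaler0 mem0v.
Qed.

Definition po_const_ideal : lieIdeal (po K N1 N2) :=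
  LieIdeal po_const_bracketr po_const_bracketl.

End Poisson.

(* h_Pi(2; (N1, N2)) and its derived algebra h'_Pi(2; (N1, N2)) *)
Definition hPi (K : fieldType) (N1 N2 : nat) : bracketAlgType K :=
  lieQuot (po_const_ideal K N1 N2).
Definition hPi' (K : fieldType) (N1 N2 : nat) : bracketAlgType K :=
  derivedAlg (hPi K N1 N2).

(* the class, modulo constants, of a generating function *)
Definition gen_class (K : fieldType) (N1 N2 : nat) (F : divpow K N1 N2) :
    hPi K N1 N2 :=
  \pi_(lieQuot (po_const_ideal K N1 N2)) (F : po K N1 N2).

Lemma hPi'_lie (K : fieldType) (N1 N2 : nat) :
  2%N \in [pchar K] -> lie_axioms (hPi' K N1 N2).
Proof. by move=> charK; apply/derivedAlg_lie/lieQuot_lie/po_lie. Qed.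

(* The binomial coefficient of integers, 0 unless 0 <= b <= a *)
Definition binz (a b : int) : nat :=
  if (0 <= b <= a) then 'C(`|a|, `|b|) else 0%N.

Definition jeta (g : nat) : int := (2 ^ g)%:Z - 1.
Definition jkappa (g h : nat) : nat := 2 ^ (g + h).

Definition jrange (g h : nat) (j : int) : bool :=
  (-1 <= j <= (jkappa g h)%:Z - 3).

Definition jshift (g s t : nat) : int := (s * t)%:Z * (1 - jeta g).

Definition jcoef (g h : nat) (i j : int) (s t : nat) : nat :=
  let e := jshift g s t in
  if jrange g h (i + j + e)
  then ((binz (i + j + 1 + e)%R (i + 1)%R
         + binz (i + j + 1 + e)%R (j + 1)%R) %% 2)%N
  else 0%N.

(* The Jurman algebra j(g, h).  Its Lie identities are not proved here: they
   follow from [lie_iso_axioms] and [hPi'_lie] once an isomorphism is known.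
   The entry (i, t) of a matrix is the coefficient
   of Y_(i-1)(t), so that Y_(-1)(t), ..., Y_(kappa-3)(t) is a basis. *)
Definition jurman (K : fieldType) (g h : nat) : Type :=
  'M[K]_((jkappa g h).-1, 2).

HB.instance Definition _ K g h :=
  Vector.copy (jurman K g h) 'M[K]_((jkappa g h).-1, 2).

Section Jurman.
Variables (K : fieldType) (g h : nat).
Local Notation J := (jurman K g h).

(* Y_j(t), which is 0 when j is out of range *)
Definition Y (j : int) (t : nat) : J :=
  \matrix_(i < (jkappa g h).-1, u < 2)
    ((i%:Z - 1 == j) && (u == t :> nat))%:R.

Definition jurman_bracket (x y : J) : J :=
  \sum_u \sum_v
    (x u.1 u.2 * y v.1 v.2
     * (jcoef g h (u.1%:Z - 1) (v.1%:Z - 1) u.2 v.2)%:R)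
    *: Y ((u.1%:Z - 1) + (v.1%:Z - 1) + jshift g u.2 v.2) ((u.2 + v.2) %% 2)%N.

Fact jurman_bracket_linearl y : linear (jurman_bracket^~ y).
Proof.
move=> a x z; rewrite /jurman_bracket scaler_sumr -big_split.
apply: eq_bigr => u _ /=; rewrite scaler_sumr -big_split.
apply: eq_bigr => v _ /=.
by rewrite !mxE scalerA -scalerDl !mulrDl !mulrA.
Qed.
Fact jurman_bracket_linearr x : linear (jurman_bracket x).
Proof.
move=> a y z; rewrite /jurman_bracket scaler_sumr -big_split.
apply: eq_bigr => u _ /=; rewrite scaler_sumr -big_split.
apply: eq_bigr => v _ /=; rewrite !mxE scalerA -scalerDl.
by congr (_ *: _); ring.
Qed.

HB.instance Definition _ := hasBracket.Build K J
  jurman_bracket_linearl jurman_bracket_linearr.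

Lemma jurman_bracketY (i j : int) (s t : nat) :
    jrange g h i -> jrange g h j -> (s < 2)%N -> (t < 2)%N ->
  {[Y i s, Y j t]} =
    (jcoef g h i j s t)%:R *: Y (i + j + jshift g s t) ((s + t) %% 2)%N.
Proof.
have ordE k : jrange g h k -> exists m : 'I_(jkappa g h).-1, k = m%:Z - 1.
  rewrite /jrange => /andP[k1 k2].
  have mlt : (`|(k + 1)%R| < (jkappa g h).-1)%N by lia.
  by exists (Ordinal mlt) => /=; lia.
have YE (m n : 'I_(jkappa g h).-1) (p : nat) (q : 'I_2) :
    Y (m%:Z - 1) p n q = ((n == m) && (q == p :> nat))%:R.
  rewrite mxE; congr (nat_of_bool (_ && _))%:R.
  by apply/eqP/eqP => [/addIr[/val_inj]|->].
case/ordE=> m -> /ordE[n ->] hs ht.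
rewrite -[LHS]/(jurman_bracket _ _) /jurman_bracket.
rewrite (bigD1 (m, Ordinal hs)) //= [X in _ + X]big1 ?addr0 => [|u ne].
  rewrite (bigD1 (n, Ordinal ht)) //= [X in _ + X]big1 ?addr0 => [|v ne].
    by rewrite !YE !eqxx !mul1r.
  rewrite [Y (n%:Z - 1) _ _ _]YE -[_ && _]/(v == (n, Ordinal ht)) (negPf ne).
  by rewrite mulr0n mulr0 mul0r scale0r.
apply: big1 => v _; rewrite [Y (m%:Z - 1) _ _ _]YE.
rewrite -[_ && _]/(u == (m, Ordinal hs)) (negPf ne).
by rewrite mulr0n !mul0r scale0r.
Qed.

End Jurman.

Arguments Y {K g h} j t.

(* Main.v *)
Require Import Defs.
From HB Require Import structures.
From mathcomp Require Import all_boot all_order all_algebra.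
From mathcomp Require Import ring zify.

Set Implicit Arguments.
Unset Strict Implicit.
Unset Printing Implicit Defensive.

Import GRing.Theory.

Local Open Scope ring_scope.

(** The idea is to see the algebra O(2; (g, h+1)) as a quadratic extension of a
    divided power algebra in one variable.  Put M = 2^(g-1), and for an exponent
    x = M k + l with l < M write z_x = p^(l) q^(k).  By the theorem of Lucas,
    z_x z_y = C(x+y, x) z_(x+y): the z_x with 0 <= x < 2^(g+h) span a divided
    power algebra R in one variable ([dpzM]).  As M + l is the binary sum of M
    and l, p^(M+l) q^(k) = p^(M) z_x, so that O = R + p^(M) R, a direct sum.

    The element u = p^(M) + q is the key to the isomorphism.  It has square zero,
    its q-derivative is 1, and D = {u, .} acts on R as the derivation
    z_x |-> z_(x-1), whereas the q-derivation acts as D^M.  Multiplication by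
    q^(1) maps p^(l) q^(k) to (k+1) p^(l) q^(k+1), so the proposed images of the
    basis of the Jurman algebra are
      Y_(x-1)(0) |-> u z_x,    Y_(x-2)(1) |-> T(z_x) := d_q(u z_x).
    Here T(A) = A + u A_q, where A_q = d_q A.  From u^2 = 0, d_q u = 1,
    d_q d_p u = 0 and the Leibniz rule alone, for arbitrary A and B
    ([poisson_mul_mul] and its two companions),
      {u A, u B}     = u (A DB + B DA),
      {u A, T(B)}    = T(A DB),
      {T(A), T(B)}   = u (DA B_qq + DB A_qq).
    On A = z_x and B = z_y these are the three brackets of the Jurman algebra;
    the shift by 1 - eta = 2 - 2M in the last one is the degree of d_q^2 = D^(2M)
    corrected by the offsets of the indices.  What the truncation of the indices
    discards vanishes for parity reasons: C(2^n - 1, i) is always odd, so a sum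
    of two such coefficients is even ([jgen_bracket]).

    It remains to identify the image.  The map is injective modulo constants:
    if u A + T(B) is a constant c, multiplying by u gives u B = c u, and
    multiplication by u is injective on R; B has no constant term, hence c = 0,
    B = 0, and then A = 0 ([gen_class_jmap_inj]).  The image consists of the
    classes of generating functions without the monomial of top degree
    ([gen_class_sub]), and a bracket {F, G} = d_p(F G_q) + d_q(F G_p) is of this
    kind, being a sum of derivatives.  Conversely every image of a basis element
    is a bracket ([jgen_derived]).  Hence the image is the derived algebra. *)

(** * Parity of binomial coefficients *)

(** The parities of the binomial coefficients, indexed by the two summands of the
    upper argument, are determined by Pascal's rule; this reduces Lucas-type
    statements to checking that rule. *)
Lemma odd_bin_rec (c : nat -> nat -> bool) :
    (forall y, c 0 y) -> (forall x, c x 0) ->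
    (forall x y, c x.+1 y.+1 = c x y.+1 (+) c x.+1 y) ->
  forall x y, odd 'C(x + y, x) = c x y.
Proof.
move=> c0y cx0 cS x; elim: x => [|x IHx] y; first by rewrite bin0 c0y.
elim: y => [|y IHy]; first by rewrite addn0 binn cx0.
by rewrite addSn binS oddD -{1}addSnnS IHy IHx cS addbC.
Qed.

(** Adding a and c in binary carries out of the lower m digits, and a carry makes
    the coefficient even (Kummer).  Pascal's rule reduces this to a + c = 2^m. *)
Lemma odd_bin_carry m a c : (a < 2 ^ m)%N -> (c < 2 ^ m)%N ->
  (2 ^ m <= a + c)%N -> odd 'C(a + c, a) = false.
Proof.
elim: a c => [|a IHa] c am; first by move=> cm; rewrite leqNgt cm.
elim: c => [|c IHc] cm; first by rewrite addn0 leqNgt am.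
rewrite leq_eqVlt => /predU1P[e | lt].
  by rewrite -e odd_bin_pow2 // am.
rewrite addSn binS oddD -{1}addSnnS IHc ?IHa //; lia.
Qed.

Lemma odd_bin_pred_pow2 n k : (k < 2 ^ n)%N -> odd 'C((2 ^ n).-1, k).
Proof.
elim: k => [|k IHk] kn; first by rewrite bin0.
have := @odd_bin_pow2 n k.+1 kn.
rewrite -[in X in 'C(X, _)](prednK (expn_gt0 2 n)) binS oddD IHk ?(ltnW kn) //.
by case: odd.
Qed.

(** The theorem of Lucas for the splitting of the binary digits into the lower m
    ones and the others.  Both sides obey Pascal's rule; the cases to check are
    whether or not adding 1 to either lower part produces a carry. *)
Lemma odd_bin_split m x y (M := (2 ^ m)%N) :
  odd 'C(x + y, x) =
    (x %% M + y %% M < M)%N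
    && odd ('C(x %/ M + y %/ M, x %/ M) * 'C(x %% M + y %% M, x %% M)).
Proof.
pose c x y := (x %% M + y %% M < M)%N
  && odd ('C(x %/ M + y %/ M, x %/ M) * 'C(x %% M + y %% M, x %% M)).
have M0 : (0 < M)%N by rewrite expn_gt0.
pose d k l k' l' := (l + l' < M)%N && odd ('C(k + k', k) * 'C(l + l', l)).
have cE k l k' l' : (l < M)%N -> (l' < M)%N ->
  c (k * M + l)%N (k' * M + l')%N = d k l k' l'.
  by move=> lM lM'; rewrite /c !modnMDl !divnMDl // !modn_small //
    !divn_small // !addn0.
have succE z : exists k l, [/\ (l < M)%N, z = (k * M + l)%N &
    (l.+1 < M /\ z.+1 = k * M + l.+1 \/ l.+1 = M /\ z.+1 = k.+1 * M + 0)%N].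
  exists (z %/ M)%N, (z %% M)%N; have lM := ltn_pmod z M0; split => //.
    exact: divn_eq.
  have := divn_eq z M; nia.
rewrite -[RHS]/(c x y); apply: odd_bin_rec => {x y} [y | x | x y].
- by rewrite /c mod0n div0n !add0n !bin0 ltn_pmod.
- by rewrite /c mod0n div0n !addn0 !binn ltn_pmod.
have [k [l [lM ex Hx]]] := succE x; have [k' [l' [lM' ey Hy]]] := succE y.
case: Hx Hy => [] [lS exS] [] [lS' eyS]; rewrite exS eyS ex ey !cE // /d.
- rewrite !addSn !addnS binS !oddM oddD.
  case: (ltngtP (l + l').+2 M) => [_ | _ | e] //; first by do 3!case: (odd _).
  have := @odd_bin_pow2 m l.+1; rewrite -/M -e binS oddD ltn0Sn !ltnS leq_addr.
  by move=> /(_ isT); do 3!case: (odd _).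
- rewrite !addn0 !binn lS lM addSnnS lS' [(_ + M < M)%N]ltnNge leq_addl /=.
  by rewrite !oddM addbF.
- rewrite !add0n !bin0 lS' lM' addnS -addSn lS [(M + _ < M)%N]ltnNge leq_addr /=.
  by rewrite !oddM.
- rewrite !addn0 !add0n !binn !bin0 (leq_ltn_trans _ lM) // lM lM' /=.
  by rewrite addSn !addnS binS !muln1 oddD addSn addbC.
Qed.

(** * Brackets twisted by an element of square zero *)

Section PoissonSquareZero.
Variables (K : fieldType) (charK : 2%N \in [pchar K]) (N1 N2 : nat).
Local Notation O := (divpow K N1 N2).
Implicit Types A B C : O.

Lemma dp_addxx A : A + A = 0.
Proof. by rewrite -mulr2n -scaler_nat (pcharf0 charK) scale0r. Qed.

Lemma poissonC A B : poisson A B = poisson B A.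
Proof. by rewrite /poisson addrC mulrC [dp_p A * _]mulrC. Qed.

(** In characteristic 2 the mixed second derivatives of G cancel, and the bracket
    is a divergence. *)
Lemma poissonE_div A B :
  poisson A B = dp_p (A * dp_q B) + dp_q (A * dp_p B).
Proof.
rewrite /poisson !(dp_pM charK, dp_qM charK) dp_pqC.
by rewrite addrACA dp_addxx addr0.
Qed.

Variable u : O.

(** When [dp_q u = 1] this is [dp_q (u * A)]. *)
Definition twist A : O := A + u * dp_q A.

Fact twist_linear : linear twist.
Proof.
move=> a A B; rewrite /twist dp_q_linear mulrDr -scalerAr scalerDr.
by rewrite -!addrA; congr (_ + _); rewrite addrCA.
Qed.

HB.instance Definition _ := GRing.isLinear.Build K O O *:%R twist twist_linear.

Hypotheses (uu : u * u = 0) (qu : dp_q u = 1) (qpu : dp_q (dp_p u) = 0).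
Local Notation D := (poisson u).

(* The terms that cancel in pairs are supplied as the witness C; what remains
   then holds in every commutative ring where u * u = 0. *)
Let char2_eq (A B : O) : (exists C, A = B + (C + C)) -> A = B.
Proof. by case=> C ->; rewrite dp_addxx addr0. Qed.
Let dp_pD A B : dp_p (A + B) = dp_p A + dp_p B. Proof. exact: linearD. Qed.
Let dp_qD A B : dp_q (A + B) = dp_q A + dp_q B. Proof. exact: linearD. Qed.
Let dpD := (dp_pD, dp_qD).
Let dpM := (@dp_pM K N1 N2 charK, @dp_qM K N1 N2 charK).

(** The contribution {A, B} comes with the factor u^2 and disappears. *)
Lemma poisson_mul_mul A B :
  poisson (u * A) (u * B) = u * (A * D B + B * D A).
Proof.
rewrite /poisson !dpM qu.
set m := dp_p u; set Ap := dp_p A; set Aq := dp_q A.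
set Bp := dp_p B; set Bq := dp_q B.
by apply: char2_eq; exists (m * A * B); ring: uu.
Qed.

(** In degree zero in u only A D(B) survives; the part divisible by u is its
    q-derivative, because D commutes with the q-derivation ([qpu] and
    [dp_q 1 = 0]). *)
Lemma poisson_mul_twist A B :
  poisson (u * A) (twist B) = twist (A * D B).
Proof.
rewrite /twist /poisson !(dpM, dpD) qu.
rewrite !dp_pqC ?qpu ?dp_q1.
set m := dp_p u; set Ap := dp_p A; set Aq := dp_q A.
set Bp := dp_p B; set Bq := dp_q B.
set Bpq := dp_q Bp; set Bqq := dp_q Bq; apply: char2_eq.
exists (m * A * Bq + u * Ap * Bq); ring: uu.
Qed.

(** The part of degree zero in u is
    {A, B} + D(A) B_q + D(B) A_q, which cancels because
    D(A) = A_p + u_p A_q, and likewise for B. *)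
Lemma poisson_twist_twist A B :
  poisson (twist A) (twist B) =
    u * (D A * dp_q (dp_q B) + D B * dp_q (dp_q A)).
Proof.
rewrite /twist /poisson !(dpM, dpD) qu !dp_pqC.
set m := dp_p u; set Ap := dp_p A; set Aq := dp_q A.
set Bp := dp_p B; set Bq := dp_q B.
set Bpq := dp_q Bp; set Bqq := dp_q Bq; set Apq := dp_q Ap; set Aqq := dp_q Aq.
apply: char2_eq.
exists ((Ap + m * Aq + u * Apq) * Bq + (Bp + m * Bq + u * Bpq) * Aq).
ring: uu.
Qed.

End PoissonSquareZero.

(** * The one-variable divided powers inside O(2; (m+1, n+1)) *)

Section SingleVariable.
Variables (K : fieldType) (m n : nat).
Local Notation M := (2 ^ m)%N.
Local Notation O := (divpow K m.+1 n.+1).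
Local Notation kappa := (2 ^ (m.+1 + n))%N.

Let M_gt0 : (0 < M)%N. Proof. by rewrite expn_gt0. Qed.
Let expM : (2 ^ m.+1 = M + M)%N. Proof. by rewrite expnS mul2n addnn. Qed.
Let kappaE : kappa = (2 ^ n.+1 * M)%N. Proof. by rewrite -expnD addnC addnS. Qed.

(** The divided power z_x.  Integer exponents, with z_x = 0 for x < 0, agree with
    the convention of [binz] that a binomial coefficient vanishes outside its
    triangle, so that no formula below needs side conditions on signs. *)
Definition dpz (x : int) : O :=
  if x is Posz i then pq (i %% M) (i %/ M) else 0.

Definition dpu : O := pq M 0 + pq 0 1.

Lemma dpz_nat k l : (l < M)%N -> dpz (M * k + l)%N = pq l k.
Proof.
move=> lM; rewrite /dpz mulnC modnMDl divnMDl //.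
by rewrite modn_small // divn_small // addn0.
Qed.

Lemma dpz_out (x : int) : ~~ (0 <= x < kappa%:Z) -> dpz x = 0.
Proof.
case: x => // i out; apply: pq_out; rewrite negb_and; apply/orP; right.
by rewrite -leqNgt leq_divRL // -kappaE; lia.
Qed.

(** The upper bound on x is needed: z_x vanishes from kappa on, whereas
    z_(x - M) does so only from kappa + M on. *)
Lemma dp_q_dpz (x : int) : x < kappa%:Z -> dp_q (dpz x) = dpz (x - M%:Z).
Proof.
case: x => [i | i] lt; last by rewrite linear0 [RHS]dpz_out //; lia.
have iQ : (i %/ M < 2 ^ n.+1)%N by rewrite ltn_divLR // -kappaE; lia.
have e := divn_eq i M; have lM := ltn_pmod i M_gt0.
rewrite [dpz i]/dpz dp_q_pqE iQ andbT; case: (i %/ M)%N e => [|k] e.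
  by rewrite scale0r dpz_out //; lia.
have -> : i%:Z - M%:Z = (M * k + i %% M)%N by nia.
by rewrite dpz_nat // scale1r.
Qed.

Lemma dp_q_dpu : dp_q dpu = 1.
Proof.
have Q_gt1 : (1 < 2 ^ n.+1)%N by rewrite -{1}(expn0 2) ltn_exp2l.
by rewrite linearD /= !dp_q_pqE Q_gt1 scale0r add0r scale1r.
Qed.

Lemma dp_p_dpu : dp_p dpu = pq M.-1 0.
Proof.
have M_lt : (M < 2 ^ m.+1)%N by rewrite ltn_exp2l.
by rewrite linearD /= !dp_p_pqE M_lt M_gt0 scale0r addr0 scale1r.
Qed.

Lemma dp_q_dp_p_dpu : dp_q (dp_p dpu) = 0.
Proof. by rewrite dp_p_dpu dp_q_pqE scale0r. Qed.

Hypothesis charK : 2%N \in [pchar K].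

Lemma dpzM x y : dpz x * dpz y = (binz (x + y) x)%:R *: dpz (x + y).
Proof.
case: x => [i|i]; last by rewrite /= mul0r /binz scale0r.
case: y => [j|j]; last first.
  rewrite /= mulr0 /binz; case: ifP; last by rewrite scale0r.
  lia.
have -> : binz (i + j)%R i = 'C(i + j, i) by rewrite /binz ifT //; lia.
rewrite (natr_odd charK) -PoszD (odd_bin_split m).
rewrite /dpz pqM (natr_odd charK (_ * _)) mulnC.
have eij : (i + j = (i %/ M + j %/ M) * M + (i %% M + j %% M))%N.
  by rewrite mulnDl addnACA -!divn_eq.
case: ltnP => [lt|ge] /=.
  by rewrite [in RHS]eij modnMDl divnMDl // (modn_small lt) (divn_small lt) addn0.
by rewrite oddM (odd_bin_carry _ _ ge) ?ltn_pmod // andbF !scale0r.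
Qed.

(** Both (p^(M))^2 and (q^(1))^2 vanish, the first by truncation and the second
    because C(2, 1) is even; the cross terms cancel in pairs. *)
Lemma dpu_sqr : dpu * dpu = 0.
Proof.
rewrite /dpu mulrDl !mulrDr !pqM [pq (M + M) _]pq_out -?expM ?ltnn //.
rewrite scaler0 add0r addn0 !add0n !addn0 !binn !bin0 /= !mul1n.
by rewrite addrA dp_addxx // add0r natr_odd //= scale0r.
Qed.

Lemma dpu_pq l k : (l < M)%N ->
  dpu * pq l k = pq (M + l) k + k.+1%:R *: pq l k.+1.
Proof.
move=> lM; rewrite mulrDl !pqM !add0n !bin0 muln1 mul1n bin1 add1n.
congr (_ + _); rewrite [in LHS](natr_odd charK) (odd_bin_split m) modnn.
rewrite divnn M_gt0 (modn_small lM) (divn_small lM).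
by rewrite add0n lM addn0 binn bin0 scale1r.
Qed.

(** On R, d/dz is d_p, except that it carries a borrow from the exponent of q when
    that of p is 0; the borrow is the term p^(M-1) d_q, which comes from the
    p-derivative of p^(M).  When the exponent of p is positive, this term
    vanishes by [odd_bin_carry]. *)
Lemma poisson_dpu_dpz (x : int) :
  x < kappa%:Z -> poisson dpu (dpz x) = dpz (x - 1).
Proof.
case: x => [i | i] lt; last first.
  by rewrite /poisson !linear0 !mulr0 addr0 [RHS]dpz_out //; lia.
have iQ : (i %/ M < 2 ^ n.+1)%N by rewrite ltn_divLR // -kappaE; lia.
have e := divn_eq i M; have lM := ltn_pmod i M_gt0.
rewrite /poisson dp_q_dpu dp_p_dpu mul1r [dpz i]/dpz dp_q_pqE dp_p_pqE iQ.
have -> /= : (i %% M < 2 ^ m.+1)%N by lia.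
rewrite !andbT -scalerAr pqM add0n bin0 muln1.
case: (posnP (i %% M)) => [l0 | l_gt0].
  rewrite l0 scale0r addr0 addn0 binn scale1r.
  case: (i %/ M)%N e => [|k] e; first by rewrite scale0r dpz_out //; lia.
  have -> : i%:Z - 1 = (M * k + M.-1)%N by nia.
  by rewrite dpz_nat ?prednK // scale1r.
have -> : 'C(M.-1 + i %% M, M.-1)%:R = 0 :> K.
  by rewrite natr_odd // (@odd_bin_carry m) ?prednK //; lia.
have -> : i%:Z - 1 = (M * (i %/ M) + (i %% M).-1)%N by lia.
rewrite dpz_nat ?scale0r ?scaler0 ?add0r ?scale1r //; lia.
Qed.

End SingleVariable.

(** * The coefficient of top degree and classes modulo constants *)

Section TopCoefficient.
Variables (K : fieldType) (N1 N2 : nat).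
Implicit Types (F G : divpow K N1 N2) (i : 'I_(2 ^ N1)) (j : 'I_(2 ^ N2)).

Lemma dp_p_top F i j : i.+1 = (2 ^ N1)%N -> dp_p F i j = 0.
Proof.
move=> iN; rewrite summxE big1 // => -[[a aN] b] _ /=; rewrite mxE.
case: a aN => [|a] aN /=; first by rewrite mxE mulr0.
rewrite mxE (_ : (i == a :> nat) = false) ?mulr0 //; lia.
Qed.

Lemma dp_q_top F i j : j.+1 = (2 ^ N2)%N -> dp_q F i j = 0.
Proof.
move=> jN; rewrite summxE big1 // => -[a [b bN]] _ /=; rewrite mxE.
case: b bN => [|b] bN /=; first by rewrite mxE mulr0.
rewrite mxE (_ : (j == b :> nat) = false) ?andbF ?mulr0 //; lia.
Qed.

Lemma poisson_top (charK : 2%N \in [pchar K]) F G i j :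
  i.+1 = (2 ^ N1)%N -> j.+1 = (2 ^ N2)%N -> poisson F G i j = 0.
Proof.
by move=> iN jN; rewrite poissonE_div // mxE dp_p_top // dp_q_top // addr0.
Qed.

End TopCoefficient.

Section GenClass.
Variables (K : fieldType) (N1 N2 : nat).
Local Notation O := (divpow K N1 N2).

Fact gen_class_linear : linear (@gen_class K N1 N2).
Proof. exact: (@lieQuot_pi_linear K (po K N1 N2) (po_const_ideal K N1 N2)). Qed.

HB.instance Definition _ :=
  GRing.isLinear.Build K O (hPi K N1 N2) *:%R (@gen_class K N1 N2)
    gen_class_linear.

Lemma gen_class_poisson (F G : O) :
  gen_class (poisson F G) = bracket (gen_class F) (gen_class G).
Proof. exact: pi_bracket. Qed.

Lemma gen_class_eq0 (F : O) : gen_class F = 0 -> exists c : K, F = c *: 1.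
Proof.
move=> F0; have : gen_class F = gen_class (0 : O) by rewrite F0 raddf0.
by move/lieQuot_eqP; rewrite subr0 => /vlineP.
Qed.

Lemma gen_class1 : gen_class (1 : O) = 0.
Proof.
rewrite -[RHS](raddf0 (@gen_class K N1 N2)); apply/lieQuot_eqP.
by rewrite subr0; apply: memv_line.
Qed.

Lemma gen_class_surj (v : hPi K N1 N2) : exists F : O, v = gen_class F.
Proof. by exists (repr v); rewrite /gen_class reprK. Qed.

End GenClass.

(** * The images of the basis of the Jurman algebra *)

Lemma binz_nat (n k : nat) : binz n k = 'C(n, k).
Proof. by rewrite /binz lez_nat; case: leqP => // /bin_small ->. Qed.

Lemma binz_pascal (a b : nat) : (0 < a + b)%N ->
  (binz (a%:Z + b%:Z - 1) a + binz (a%:Z + b%:Z - 1) b)%N = binz (a%:Z + b%:Z) a.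
Proof.
move=> ab; have -> : a%:Z + b%:Z - 1 = (a + b).-1 by lia.
rewrite -PoszD !binz_nat; case: a b ab => [|a] [|b] //= _.
- by rewrite bin0 bin_small.
- by rewrite !addn0 binn bin_small ?bin0.
by rewrite addSn binS; congr addn; rewrite -bin_sub ?leq_addl // addnK.
Qed.

Section JurmanImage.
Variables (K : fieldType) (charK : 2%N \in [pchar K]) (m h : nat).
Local Notation M := (2 ^ m)%N.
Local Notation O := (divpow K m.+1 h.+1).
Local Notation J := (jurman K m.+1 h).
Local Notation H := (hPi K m.+1 h.+1).
Local Notation kappa := (jkappa m.+1 h).
Local Notation jrange := (jrange m.+1 h).
Local Notation u := (dpu K m h).
Local Notation dpz := (dpz K m h).
Local Open Scope lie_scope.

Let kappaE : kappa = (2 ^ h.+1 * M)%N. Proof. by rewrite -expnD addnC addnS. Qed.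
Let jetaE : jeta m.+1 = M%:Z + M%:Z - 1.
Proof. by rewrite /jeta expnS mul2n -addnn. Qed.
Let dpz0 : dpz 0 = 1. Proof. by rewrite /= mod0n div0n. Qed.
Let uu := @dpu_sqr K m h charK.
Let qu := @dp_q_dpu K m h.
Let qpu := @dp_q_dp_p_dpu K m h.

(** The generating function for the image of Y_j(t). *)
Definition jgen (j : int) (t : nat) : O :=
  if t == 0 then u * dpz (j + 1) else twist u (dpz (j + 2)).

Definition jmap (x : J) : O :=
  \sum_w x w.1 w.2 *: jgen (w.1%:Z - 1) w.2.

Fact jmap_linear : linear jmap.
Proof.
move=> a x y; rewrite /jmap scaler_sumr -big_split; apply: eq_bigr => w _ /=.
by rewrite !mxE scalerA -scalerDl.
Qed.

HB.instance Definition _ := GRing.isLinear.Build K J O *:%R jmap jmap_linear.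

Lemma jmapY j t : jrange j -> (t < 2)%N -> jmap (Y j t) = jgen j t.
Proof.
rewrite /jrange => jr t2.
have ilt : (`|(j + 1)%R| < kappa.-1)%N by lia.
have ei : `|(j + 1)%R|%N%:Z - 1 = j by lia.
rewrite /jmap (bigD1 (Ordinal ilt, Ordinal t2)) //= big1 => [|[i w] ne].
  by rewrite mxE /= ei !eqxx scale1r addr0.
rewrite mxE /=; case: andP => [[/eqP e1 /eqP e2] | _]; last by rewrite scale0r.
case/negP: ne; rewrite xpair_eqE -!val_eqE /= e2 eqxx andbT; apply/eqP; lia.
Qed.

Lemma jcoef_natr i j s t : jrange (i + j + jshift m.+1 s t) ->
  (jcoef m.+1 h i j s t)%:R
    = (binz (i + j + 1 + jshift m.+1 s t) (i + 1)
       + binz (i + j + 1 + jshift m.+1 s t) (j + 1))%:R :> K.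
Proof. by move=> r; rewrite /jcoef r modn2 -natr_odd. Qed.

Lemma jcoef_out i j s t : ~~ jrange (i + j + jshift m.+1 s t) ->
  jcoef m.+1 h i j s t = 0%N.
Proof. by rewrite /jcoef => /negPf ->. Qed.

(** This parity makes the coefficient of the first index beyond the range of the
    Jurman basis vanish, in [jgen0_jcoef]. *)
Lemma odd_binz_pred_kappa (x : int) : 0 <= x < kappa%:Z ->
  odd (binz (kappa%:Z - 1) x).
Proof.
case: x => // x xk; have -> : kappa%:Z - 1 = kappa.-1 by lia.
by rewrite binz_nat odd_bin_pred_pow2.
Qed.

(** The common end of the brackets of two elements of the same kind.  If N is out
    of range, the right-hand side is 0 by definition and the left-hand side is 0
    for one of two reasons: either z_(N+1) = 0, or N + 1 = kappa - 1 and the two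
    binomial coefficients are both odd. *)
Lemma jgen0_jcoef i j s t N : jrange i -> jrange j ->
  N = i + j + jshift m.+1 s t ->
  (binz (N + 1) (i + 1) + binz (N + 1) (j + 1))%:R *: jgen N 0
    = (jcoef m.+1 h i j s t)%:R *: jmap (Y N 0).
Proof.
move=> ir jr NE.
have e1 : i + j + 1 + jshift m.+1 s t = N + 1 by rewrite NE; ring.
have [Nr | Nout] := boolP (jrange N).
  by rewrite jcoef_natr -?NE // e1 jmapY.
rewrite jcoef_out -?NE // scale0r /jgen eqxx.
have [Nk | Nk] := eqVneq (N + 1) (kappa%:Z - 1).
  rewrite Nk natr_odd // oddD !odd_binz_pred_kappa ?scale0r //.
    by move: jr; rewrite /jrange; lia.
  by move: ir; rewrite /jrange; lia.
rewrite dpz_out ?mulr0 ?scaler0 //.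
by move: Nout Nk; rewrite /jrange /jkappa; lia.
Qed.

(** Modulo constants the images obey the multiplication table of the Jurman
    algebra.  Constants matter only for [Y_(-1)(0)] and [Y_(-1)(1)], whose
    bracket is 0 whereas the bracket of their images is T(z_0) = 1. *)
Lemma jgen_bracket i j s t : jrange i -> jrange j -> (s < 2)%N -> (t < 2)%N ->
  {[gen_class (jgen i s), gen_class (jgen j t)]} =
    (jcoef m.+1 h i j s t)%:R *:
      gen_class (jmap (Y (i + j + jshift m.+1 s t) ((s + t) %% 2)%N)).
Proof.
pose L i j s t := {[gen_class (jgen i s), gen_class (jgen j t)]}.
pose Q i j s t := (jcoef m.+1 h i j s t)%:R *:
      gen_class (jmap (Y (i + j + jshift m.+1 s t) ((s + t) %% 2)%N)).
have sym a b s' t' : L a b s' t' = Q a b s' t' -> L b a t' s' = Q b a t' s'.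
  rewrite /L -!gen_class_poisson poissonC => ->; rewrite /Q /jcoef.
  rewrite /jshift ![(b + a)%R]addrC ![(t' * s')%N]mulnC ![(t' + s')%N]addnC.
  by case: ifP => // _; rewrite [(binz _ (b + 1) + _)%N]addnC.
have lt_kappa a : jrange a -> (a + 2 < kappa%:Z)%R by rewrite /jrange; lia.
have lt_kappa' a : jrange a -> (a + 1 < kappa%:Z)%R by rewrite /jrange; lia.
have ltr_subM a : jrange a -> (a + 2 - M%:Z < kappa%:Z)%R by rewrite /jrange; lia.
move=> ir jr.
have case01 a b : jrange a -> jrange b -> L a b 0 1 = Q a b 0 1.
  move=> ar br; rewrite /L /Q -gen_class_poisson /jgen /=.
  rewrite (poisson_mul_twist charK uu qu qpu) poisson_dpu_dpz ?lt_kappa //.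
  rewrite (_ : jshift m.+1 0 1 = 0) ?addr0; last by rewrite /jshift mul0r.
  rewrite (dpzM _ _ charK) !linearZ /=.
  have -> : a + 1 + (b + 2 - 1) = a + b + 2 by ring.
  have [Nr | Nout] := boolP (jrange (a + b)).
    (* The table has the two terms of Pascal's rule for the one found here. *)
    rewrite jmapY // jcoef_natr /jshift ?mul0n ?mul0r ?addr0 //.
    have natE c : jrange c -> exists n : nat, c + 1 = n.
      by rewrite /jrange => cr; exists `|(c + 1)%R|%N; lia.
    have [[a' ea] [b' eb]] := (natE a ar, natE b br).
    have -> : a + b + 1 = a'%:Z + b'%:Z - 1 by rewrite -ea -eb; ring.
    rewrite ea eb binz_pascal; last by move: Nr; rewrite /jrange; lia.
    by rewrite (_ : a'%:Z + b'%:Z = a + b + 2) // -ea -eb; ring.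
  rewrite jcoef_out /jshift ?mul0n ?mul0r ?addr0 // scale0r.
  (* Only z_0 = 1, which is killed modulo constants, is not already 0. *)
  have [e0 | ne0] := eqVneq (a + b + 2) 0.
    by rewrite e0 /twist dpz0 dp_q1 mulr0 addr0 gen_class1 scaler0.
  rewrite dpz_out ?linear0 ?raddf0 ?scaler0 //.
  by move: ar br Nout ne0; rewrite /jrange /jkappa; lia.
case: s => [|[|//]] _; case: t => [|[|//]] _ //.
- rewrite -gen_class_poisson {1 2}/jgen /= (poisson_mul_mul charK uu qu).
  rewrite !poisson_dpu_dpz ?lt_kappa' // !(dpzM _ _ charK).
  have -> : i + 1 + (j + 1 - 1) = i + j + 1 by ring.
  have -> : j + 1 + (i + 1 - 1) = i + j + 1 by ring.
  have NE : i + j = i + j + jshift m.+1 0 0 by rewrite /jshift mul0r addr0.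
  rewrite -scalerDl -natrD -scalerAr -NE -[u * _]/(jgen (i + j) 0).
  by rewrite (jgen0_jcoef ir jr NE) linearZ.
- exact: case01.
- by apply: sym; apply: case01.
rewrite -gen_class_poisson {1 2}/jgen /= (poisson_twist_twist charK uu qu).
rewrite !poisson_dpu_dpz ?lt_kappa // !dp_q_dpz ?lt_kappa ?ltr_subM //.
rewrite !(dpzM _ _ charK).
set N : int := i + j + _.
have NE : i + 2 - 1 + (j + 2 - M%:Z - M%:Z) = N + 1.
  by rewrite /N /jshift jetaE mul1r; ring.
have NE' : j + 2 - 1 + (i + 2 - M%:Z - M%:Z) = N + 1 by rewrite -NE; ring.
rewrite NE NE'.
have -> : i + 2 - 1 = i + 1 by ring.
have -> : j + 2 - 1 = j + 1 by ring.
rewrite -scalerDl -natrD -scalerAr -[u * _]/(jgen N 0).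
by rewrite (jgen0_jcoef ir jr (erefl N)) linearZ.
Qed.

(** As z_x = D(z_(x+1)), bracketing with u = u z_0 suffices:
    u z_x = {u, u z_(x+1)} and T(z_x) = {u, T(z_(x+1))}.  For the last T(z_x),
    with x = kappa - 1, the required z_(x+1) is 0; instead one uses
    {u z_1, T(z_x)} = T(z_1 D(z_x)), where z_1 D(z_x) = C(kappa - 1, 1) z_x is an
    odd multiple of z_x. *)
Lemma jgen_derived j t : jrange j -> (t < 2)%N ->
  gen_class (jgen j t) \in derived H.
Proof.
have dpz1 : poisson u (1 : O) = 0.
  by rewrite -dpz0 (poisson_dpu_dpz charK) //; rewrite ltz_nat expn_gt0.
have mem F G : gen_class (poisson F G) \in derived H.
  by rewrite gen_class_poisson mem_derived.
move=> jr; case: t => [|[|//]] _; rewrite /jgen /=.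
  have <- : poisson u (u * dpz (j + 2)) = u * dpz (j + 1).
    rewrite -[X in poisson X]mulr1 (poisson_mul_mul charK uu qu).
    rewrite dpz1 mulr0 addr0 mul1r.
    rewrite (poisson_dpu_dpz charK); last by move: jr; rewrite /jrange /jkappa; lia.
    by congr (_ * dpz _); ring.
  exact: mem.
have [jk | jk] := eqVneq (j + 2) (kappa%:Z - 1); last first.
  have <- : poisson u (twist u (dpz (j + 3))) = twist u (dpz (j + 2)).
    rewrite -[X in poisson X]mulr1 (poisson_mul_twist charK uu qu qpu) mul1r.
    rewrite (poisson_dpu_dpz charK); last first.
      by move: jr jk; rewrite /jrange /jkappa; lia.
    by congr (twist u (dpz _)); ring.
  exact: mem.
have <- : poisson (u * dpz 1) (twist u (dpz (j + 2))) = twist u (dpz (j + 2)).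
  rewrite (poisson_mul_twist charK uu qu qpu).
  rewrite (poisson_dpu_dpz charK); last by move: jk; rewrite /jkappa; lia.
  rewrite (dpzM _ _ charK) (_ : 1 + (j + 2 - 1) = j + 2) ?jk; last by ring.
  rewrite natr_odd // odd_binz_pred_kappa ?scale1r //.
  by move: jr; rewrite /jrange; lia.
exact: mem.
Qed.

Lemma jmap_derived x : gen_class (jmap x) \in derived H.
Proof.
rewrite /jmap linear_sum; apply: memv_suml => -[i t] _.
rewrite linearZ memvZ // jgen_derived //=; move: (ltn_ord i); rewrite /jrange; lia.
Qed.

(** * The isomorphism *)

Lemma jmap_morph x y :
  gen_class (jmap {[x, y]}) = {[gen_class (jmap x), gen_class (jmap y)]}.
Proof.
have ir (i : 'I_kappa.-1) : jrange (i%:Z - 1).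
  by move: (ltn_ord i); rewrite /jrange; lia.
have jE z : gen_class (jmap z) =
    \sum_w z w.1 w.2 *: gen_class (jgen (w.1%:Z - 1) w.2).
  by rewrite /jmap linear_sum; apply: eq_bigr => w _; rewrite linearZ.
rewrite (jE x) (jE y) bracket_suml.
pose phi : {linear J -> H} := @gen_class K m.+1 h.+1 \o jmap.
rewrite -[LHS]/(phi (jurman_bracket x y)) (linear_sum phi).
apply: eq_bigr => a _; rewrite bracket_sumr (linear_sum phi).
apply: eq_bigr => b _; rewrite linearZ_LR bracketZl bracketZr.
rewrite jgen_bracket ?ltn_ord //.
by rewrite !scalerA ?mulrA.
Qed.

(** Multiplication by u is injective on R: the rows of the matrix of u z_x with
    index at least M hold p^(M) z_x alone. *)
Lemma dpu_dpz_free N (a : 'I_N -> K) : (N <= kappa)%N ->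
  u * (\sum_(i < N) a i *: dpz i) = 0 -> forall i, a i = 0.
Proof.
move=> Nk E i; have M_gt0 : (0 < M)%N by rewrite expn_gt0.
have iQ : (i %/ M < 2 ^ h.+1)%N.
  by rewrite ltn_divLR // -kappaE (leq_trans (ltn_ord i)).
have rlt : (M + i %% M < 2 ^ m.+1)%N.
  by rewrite expnS mul2n -addnn ltn_add2l ltn_pmod.
have entry (j : nat) :
  (u * dpz j) (Ordinal rlt) (Ordinal iQ) = (j == i)%:R.
  rewrite /= (dpu_pq _ charK) ?ltn_pmod // !mxE /= eqn_add2l.
  rewrite [(M + _ == j %% M)%N]gtn_eqF ?mulr0 ?addr0; last first.
    by rewrite (leq_trans (ltn_pmod _ M_gt0)) ?leq_addr.
  congr (nat_of_bool _)%:R; apply/andP/eqP => [[/eqP e1 /eqP e2] | ->] //.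
  by rewrite [RHS](divn_eq _ M) e1 e2 -divn_eq.
have := congr1 (fun F : O => F (Ordinal rlt) (Ordinal iQ)) E.
rewrite mulr_sumr summxE mxE (bigD1 i) //= big1 => [|j ne].
  by rewrite -scalerAr mxE entry eqxx mulr1 addr0.
by rewrite -scalerAr mxE entry (negPf ne : (j == i :> nat) = false) mulr0.
Qed.

Lemma gen_class_jmap_inj : injective (@gen_class K m.+1 h.+1 \o jmap).
Proof.
apply: raddf_inj => x /= /gen_class_eq0 [c xc].
pose A := \sum_(i < kappa.-1) x i 0 *: dpz i.
pose B := \sum_(i < kappa.-1) x i 1 *: dpz i.+1.
have xE : jmap x = u * A + twist u B.
  rewrite /jmap -(pair_bigA _ (fun i t => x i t *: jgen (i%:Z - 1) t)) /=.
  rewrite /A /B mulr_sumr linear_sum -big_split; apply: eq_bigr => i _.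
  rewrite big_ord_recl big_ord1 /jgen /= subrK -scalerAr linearZ.
  rewrite (_ : i%:Z - 1 + 2 = i.+1); last lia.
  by rewrite (_ : lift ord0 ord0 = 1) //; apply: val_inj.
have B0 : u * (B - c *: dpz 0) = 0.
  rewrite mulrBr -scalerAr dpz0 mulr1.
  have : u * jmap x = c *: u by rewrite xc -scalerAr mulr1.
  by rewrite xE /twist !mulrDr !mulrA uu !mul0r addr0 add0r => ->; rewrite subrr.
have kE : kappa = kappa.-1.+1 by rewrite prednK ?expn_gt0.
(* The coefficients of B - c z_0: those of B start at z_1, so c sits at index 0. *)
pose b (i : 'I_kappa.-1.+1) := if unlift ord0 i is Some j then x j 1 else - c.
have b0 : forall i, b i = 0.
  apply: dpu_dpz_free; first by rewrite -kE.
  rewrite big_ord_recl {1}/b unlift_none scaleNr addrC -[RHS]B0; congr (_ * (_ + _)).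
  by apply: eq_bigr => i _; rewrite /b liftK.
have x1 i : x i 1 = 0 by have := b0 (lift ord0 i); rewrite /b liftK.
have c0 : c = 0.
  by have := b0 ord0; rewrite /b unlift_none => /eqP; rewrite oppr_eq0 => /eqP.
have x0 : forall i, x i 0 = 0.
  apply: dpu_dpz_free; first by rewrite leq_pred.
  rewrite -/A; move: xE; rewrite xc c0 scale0r /B big1 ?linear0 ?addr0 // => i _.
  by rewrite x1 scale0r.
apply/matrixP => i t; rewrite mxE.
have [-> // | -> //] : t = 0 \/ t = 1.
by case: t => [[|[|//]] t2]; [left | right]; apply: val_inj.
Qed.

(** Every class without the top monomial comes from the images: first
    z_x = T(z_x) + u z_(x-M), then p^(M+l) q^(b) = u z_x + (b+1) z_(x+M) with
    x = M b + l.  The only missing element u z_(kappa-1) is the top monomial. *)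
Lemma gen_class_sub (W : {vspace H}) :
  (forall j t, jrange j -> (t < 2)%N -> gen_class (jgen j t) \in W) ->
  forall F : O, (forall (i : 'I_(2 ^ m.+1)) (j : 'I_(2 ^ h.+1)),
    i.+1 = (2 ^ m.+1)%N -> j.+1 = (2 ^ h.+1)%N -> F i j = 0) ->
  gen_class F \in W.
Proof.
move=> sW.
have sW0 (i : nat) : (i < kappa.-1)%N -> gen_class (u * dpz i) \in W.
  move=> ik; have := sW (i%:Z - 1) 0%N; rewrite /jgen subrK; apply=> //.
  by rewrite /jrange; lia.
have sWz (i : nat) : (i < kappa)%N -> gen_class (dpz i) \in W.
  move=> ik; case: i ik => [|i] ik; first by rewrite dpz0 gen_class1 mem0v.
  have := sW (i%:Z - 1) 1%N; rewrite /jgen /= (_ : i%:Z - 1 + 2 = i.+1); last lia.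
  rewrite /twist linearD /= => /(_ _ isT) sWi.
  rewrite -[gen_class _](addrK (gen_class (u * dp_q (dpz i.+1)))).
  apply: memvB; first by apply: sWi; rewrite /jrange; lia.
  rewrite dp_q_dpz; last by rewrite ltz_nat.
  have [iM | iM] := leqP M i.+1; last first.
    by rewrite dpz_out ?mulr0 ?raddf0 ?mem0v //; lia.
  rewrite (_ : i.+1%:Z - M%:Z = (i.+1 - M)%N); last lia.
  by apply: sW0; have := expn_gt0 2 m; lia.
have expM : (2 ^ m.+1 = M + M)%N by rewrite expnS mul2n addnn.
move=> F top0; rewrite [F]pq_sum linear_sum; apply: memv_suml => -[a b] _ /=.
rewrite linearZ /=; have [aM | aM] := ltnP a M.
  rewrite memvZ // -(dpz_nat K h b aM) sWz //; have := ltn_ord b; nia.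
pose l := (a - M)%N; have aE : (a : nat) = (M + l)%N by rewrite subnKC.
have lM : (l < M)%N by have := ltn_ord a; lia.
have [top | ntop] := eqVneq (M * b + l)%N kappa.-1.
  rewrite top0 ?scale0r ?mem0v //; have := ltn_ord b; nia.
rewrite memvZ // aE -[pq _ _](addrK (b.+1%:R *: pq l b.+1)) -(dpu_pq _ charK) //.
rewrite linearB linearZ memvB //.
  by rewrite -(dpz_nat K h b lM) sW0 //; have := ltn_ord b; nia.
rewrite memvZ //; have [bQ | bQ] := ltnP b.+1 (2 ^ h.+1).
  by rewrite -(dpz_nat K h b.+1 lM) sWz //; nia.
by rewrite pq_out ?raddf0 ?mem0v // negb_and -!leqNgt bQ orbT.
Qed.

(** The projection onto the derived algebra is the identity on the image of
    [jmap], by [jmap_derived]; it only serves to give the map its codomain. *)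
Definition jiso (x : J) : hPi' K m.+1 h.+1 :=
  vsproj (derived H) (gen_class (jmap x)).

Fact jiso_linear : linear jiso.
Proof. by move=> a x y; rewrite /jiso !linearP. Qed.

HB.instance Definition _ :=
  GRing.isLinear.Build K J (hPi' K m.+1 h.+1) *:%R jiso jiso_linear.

Lemma vsval_jiso x : vsval (jiso x) = gen_class (jmap x).
Proof. by rewrite vsprojK ?jmap_derived. Qed.

Lemma derived_sub_jmap (v : H) : v \in derived H ->
  exists x, v = gen_class (jmap x).
Proof.
pose phi : {linear J -> H} := @gen_class K m.+1 h.+1 \o jmap.
suff sW : (derived H <= limg (linfun phi))%VS.
  move=> /(subvP sW)/memv_imgP[x _ ->]; exists x; exact: lfunE.
apply: derived_min => a b; have [F ->] := gen_class_surj a.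
have [G ->] := gen_class_surj b; rewrite -gen_class_poisson.
apply: gen_class_sub => [j t jr t2 | i j iN jN]; last exact: poisson_top.
by rewrite -jmapY // -[gen_class _](lfunE phi) memv_img ?memvf.
Qed.

Lemma jiso_lie_iso : lie_iso jiso.
Proof.
split; last first.
  by move=> x y; apply: subvs_inj; rewrite derived_bracketE !vsval_jiso jmap_morph.
have inj : injective jiso.
  by move=> x y e; apply: gen_class_jmap_inj; rewrite /= -!vsval_jiso e.
have surj v : exists x, v = jiso x.
  have [x vx] := derived_sub_jmap (subvsP v).
  by exists x; apply: subvs_inj; rewrite vsval_jiso.
have surjb v : exists x, v == jiso x by have [x ->] := surj v; exists x.
exists (fun v => xchoose (surjb v)) => [x | v].
  by apply: inj; rewrite -(eqP (xchooseP (surjb _))).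
exact: esym (eqP (xchooseP (surjb v))).
Qed.

Lemma jgen0E k l : (l < M)%N ->
  jgen ((M * k + l)%:Z - 1) 0 = pq (M + l) k + k.+1%:R *: pq l k.+1.
Proof. by move=> lM; rewrite /jgen /= subrK (dpz_nat K h k lM) dpu_pq. Qed.

Lemma jgen1E k l : (k < 2 ^ h.+1)%N -> (l < M)%N ->
  jgen ((M * k + l)%:Z - 2) 1 =
    if (0 < k)%N then pq (M + l) k.-1 + k.+1%:R *: pq l k else pq l 0.
Proof.
move=> kQ lM; rewrite /jgen [_ == _]/= subrK (dpz_nat K h k lM).
rewrite /twist dp_q_pqE kQ andbT; case: k kQ => [|k] _ /=.
  by rewrite scale0r mulr0 addr0.
by rewrite scale1r dpu_pq // addrCA -{1}[pq l k.+1]scale1r -scalerDl nat1r.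
Qed.

End JurmanImage.

Theorem proposition4p3 (K : closedFieldType) (charK : 2%N \in [pchar K])
    (g h : nat) (g_ge2 : (2 <= g)%N) (h_ge1 : (1 <= h)%N) :
  exists f : {linear jurman K g h -> hPi' K g h.+1},
    [/\ lie_iso f,
        forall k l : nat, (k < 2 ^ h.+1)%N -> (l < 2 ^ g.-1)%N ->
          let j := (2 ^ g.-1 * k + l)%:Z - 1 in
          jrange g h j ->
          vsval (f (Y j 0)) =
            gen_class (pq (2 ^ g.-1 + l) k + k.+1%:R *: pq l k.+1)
      & forall k l : nat, (k < 2 ^ h.+1)%N -> (l < 2 ^ g.-1)%N ->
          let j := (2 ^ g.-1 * k + l)%:Z - 2 in
          jrange g h j ->
          vsval (f (Y j 1)) =
            gen_class (if (0 < k)%N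
                       then pq (2 ^ g.-1 + l) k.-1 + k.+1%:R *: pq l k
                       else pq l 0)].
Proof.
case: g g_ge2 => [//|m] _; exists (@jiso K m h).
split=> [|k l kQ lM j jr|k l kQ lM j jr]; first exact: jiso_lie_iso.
  by rewrite vsval_jiso // jmapY // jgen0E.
by rewrite vsval_jiso // jmapY // jgen1E.
Qed.
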